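(* Let $\phi:\mathbb R\to\mathbb R$ be bounded and one-periodic, let $0<a<1$ and $b>1$, and let $W(x)=\sum_{n=0}^\infty a^n\phi(b^nx)$. Then for every integer $m\ge1$ and every $x>0$, $$\mathcal J_{b^m}W(x)=\frac{(a^{-m}-1)\,W(x)-a^{-m}\displaystyle\sum_{j=0}^{m-1}a^j\phi(b^jx)}{(b^m-1)\,x}.$$ In particular, $$\mathcal J_bW(x)=\frac{(a^{-1}-1)\,W(x)-a^{-1}\phi(x)}{(b-1)\,x}.$$
   Context: For $c>1$ and a function $f$, the Jackson quotient is $$\mathcal J_cf(x)=\frac{f(cx)-f(x)}{(c-1)x},\qquad x>0.$$ *)

(* Defs.v *)
From HB Require Import structures.
From mathcomp Require Import all_boot all_order all_algebra.
From mathcomp Require Import all_classical all_reals all_analysis.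
Import Order.TTheory GRing.Theory Num.Theory.
Import numFieldNormedType.Exports.

Set Implicit Arguments.
Unset Strict Implicit.
Unset Printing Implicit Defensive.

Local Open Scope classical_set_scope.
Local Open Scope ring_scope.

(* Only meaningful for 1 < c and 0 < x. *)
Definition jackson (R : realType) (c : R) (f : R -> R) (x : R) : R :=
  (f (c * x) - f x) / ((c - 1) * x).

(* [limn] is the actual sum of the series when it converges, which is the case
   at every x as soon as phi is bounded and `|a| < 1. *)
Definition weierstrass (R : realType) (phi : R -> R) (a b : R) (x : R) : R :=
  limn (series (fun n : nat => a ^+ n * phi (b ^+ n * x))).

(* Main.v *)
Require Import Defs.
From HB Require Import structures.
From mathcomp Require Import all_boot all_order all_algebra.
From mathcomp Require Import all_classical all_reals all_analysis.
From mathcomp Require Import ring.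
Import Order.TTheory GRing.Theory Num.Theory.
Import numFieldNormedType.Exports.

Local Open Scope classical_set_scope.
Local Open Scope ring_scope.

(** The Weierstrass series is self-similar: replacing [x] by [b ^+ m * x] shifts
    the summation index by [m] and costs a factor [a ^+ m].  Splitting the
    series after its first [m] terms therefore gives
    [W x = \sum_(j < m) a ^+ j * phi (b ^+ j * x) + a ^+ m * W (b ^+ m * x)]
    ([weierstrass_split]).  Solving this identity for [W (b ^+ m * x)], which is
    possible as [a != 0], and substituting the result into the Jackson quotient
    is the claim; the second formula is the case [m = 1].

    The only analytic input is that the series converges
    ([is_cvg_weierstrass]): [W] is defined as a limit, and the splitting
    identity manipulates it as a genuine sum.  This follows from the bound on
    [phi] by comparison with a geometric series. *)

Lemma is_cvg_weierstrass (R : realType) (phi : R -> R) (a b x : R) :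
  bounded_fun phi -> `|a| < 1 ->
  cvgn (series (fun n : nat => a ^+ n * phi (b ^+ n * x))).
Proof.
move=> phib a1; have [M M_gt0 phiM] := pinfty_ex_gt0 phib; apply: normed_cvg.
apply: (@series_le_cvg _ _ (geometric M `|a|)) => [n|n|n|] //=.
- by rewrite mulr_ge0 ?exprn_ge0// ltW.
- by rewrite normrM normrX mulrC ler_wpM2r ?exprn_ge0//; exact: phiM.
- by apply: is_cvg_geometric_series; rewrite normr_id.
Qed.

(** The tail of the series at [x] is, term by term, [a ^+ m] times the whole
    series at [b ^+ m * x]; convergence of the latter lets the factor pass
    through the limit. *)
Lemma weierstrass_split (R : realType) (phi : R -> R) (a b x : R) (m : nat) :
  bounded_fun phi -> `|a| < 1 ->
  weierstrass phi a b x =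
    \sum_(0 <= j < m) a ^+ j * phi (b ^+ j * x)
    + a ^+ m * weierstrass phi a b (b ^+ m * x).
Proof.
move=> phib a1; apply: (@cvg_lim _ (@Rhausdorff R)).
rewrite -(cvg_shiftn m).
have shiftE n : series (fun k => a ^+ k * phi (b ^+ k * x)) (n + m)%N =
    \sum_(0 <= j < m) a ^+ j * phi (b ^+ j * x) +
    a ^+ m * series (fun k => a ^+ k * phi (b ^+ k * (b ^+ m * x))) n.
  rewrite /series /= (big_cat_nat (leq0n m) (leq_addl n m)) /=; congr +%R.
  rewrite -{1}(add0n m) big_addn addnK mulr_sumr.
  by apply: eq_bigr => k _; rewrite !exprD !mulrA [a ^+ m * _]mulrC.
rewrite (funext shiftE).
by apply: cvgD; [exact: cvg_cst | apply: cvgMl_tmp; exact: is_cvg_weierstrass].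
Qed.

Lemma jackson_weierstrass (R : realType) (phi : R -> R) (a b x : R) (m : nat) :
  bounded_fun phi -> `|a| < 1 -> a != 0 ->
  jackson (b ^+ m) (weierstrass phi a b) x =
    ((a ^- m - 1) * weierstrass phi a b x
       - a ^- m * (\sum_(0 <= j < m) a ^+ j * phi (b ^+ j * x)))
    / ((b ^+ m - 1) * x).
Proof.
move=> phib a1 a0; rewrite /jackson; congr (_ / _).
have -> : weierstrass phi a b (b ^+ m * x) =
    a ^- m * (weierstrass phi a b x
              - \sum_(0 <= j < m) a ^+ j * phi (b ^+ j * x)).
  by rewrite (weierstrass_split _ _ _ b x m phib a1) addrAC subrr add0r mulKf ?expf_neq0.
by ring.
Qed.

Theorem proposition2p2 (R : realType) (phi : R -> R) (a b : R)
    (phi_bounded : bounded_fun phi) (phi_periodic : periodic phi 1)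
    (a_gt0 : 0 < a) (a_lt1 : a < 1) (b_gt1 : 1 < b) :
  let W := weierstrass phi a b in
  (forall (m : nat) (x : R), (1 <= m)%N -> 0 < x ->
     jackson (b ^+ m) W x =
       ((a ^- m - 1) * W x
          - a ^- m * (\sum_(0 <= j < m) a ^+ j * phi (b ^+ j * x)))
       / ((b ^+ m - 1) * x)) /\
  (forall x : R, 0 < x ->
     jackson b W x = ((a^-1 - 1) * W x - a^-1 * phi x) / ((b - 1) * x)).
Proof.
have a0 : a != 0 by rewrite gt_eqF.
have a1 : `|a| < 1 by rewrite gtr0_norm.
split=> [m x _ _|x _]; first exact: jackson_weierstrass.
by have := jackson_weierstrass _ _ _ b x 1 phi_bounded a1 a0;
  rewrite big_nat1 !expr1 !expr0 !mul1r.
Qed.
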